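(* Let $X$ be a compact topological space and take all coefficients in a field $\mathbb K$. Let $q\ge 0$, and for $z\in\check H^q(X)$, $\gamma\in\check H_q(X)$ let $\int_\gamma z\in\mathbb K$ be the integral. Then: (1) The canonical map $\check H_q(X)\to \mathrm{Hom}(\check H^q(X),\mathbb K)$, $\gamma\mapsto\bigl(z\mapsto\int_\gamma z\bigr)$, is an isomorphism. (2) The canonical map $\check H^q(X)\to \mathrm{Hom}(\check H_q(X),\mathbb K)$, $z\mapsto\bigl(\gamma\mapsto\int_\gamma z\bigr)$, is injective. It is an isomorphism if either one of $\check H_q(X)$ or $\check H^q(X)$ is finite dimensional (in which case both are).
   Context: Let $\mathcal U$ be an open covering of $X$; coefficients are in $\mathbb K$. Homology. A formal $q$-simplex is an ordered tuple $\sigma=(x_0\ \ldots\ x_q)$ of points of $X$ (repetitions allowed); it is $\mathcal U$-small if all $x_i$ lie in a common element of $\mathcal U$. A formal $q$-chain is a finite linear combination $\sum k_i\sigma_i$ of formal $q$-simplices; it is $\mathcal U$-small if all the $\sigma_i$ are. The $\mathcal U$-small $q$-chains form $S^{\mathcal U}_q(X)$, with boundary $\partial(x_0\ \ldots\ x_q)=\sum_{j=0}^q(-1)^j(x_0\ \ldots\ \widehat{x_j}\ \ldots\ x_q)$. $H_q^{\mathcal U}(X)$ is the $q$-th homology of this complex. If $\mathcal V$ refines $\mathcal U$, inclusion of chains induces $H_q^{\mathcal V}(X)\to H_q^{\mathcal U}(X)$, and $\check H_q(X)=\varprojlim_{\mathcal U}H_q^{\mathcal U}(X)$ (Čech homology).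 An element $\gamma\in\check H_q(X)$ is a coherent family $(\gamma^{\mathcal U})_{\mathcal U}$; a $\mathcal U$-small representative of $\gamma$ is a $\mathcal U$-small cycle representing $\gamma^{\mathcal U}$. Cohomology. $C^q(X)$ is the space of all functions $\xi\colon X^{q+1}\to\mathbb K$, with $\delta\xi(x_0,\ldots,x_{q+1})=\sum_{j=0}^{q+1}(-1)^j\xi(x_0,\ldots,\widehat{x_j},\ldots,x_{q+1})$. A cochain is $\mathcal U$-locally zero if it vanishes on all tuples contained in a single member of $\mathcal U$, and locally zero if it is $\mathcal U$-locally zero for some open covering $\mathcal U$. $\check H^q(X)$ is the Alexander--Spanier cohomology, i.e. the cohomology of $C^*(X)$ modulo locally zero cochains (isomorphic to Čech cohomology). Integral. For $z\in\check H^q(X)$ and $\gamma\in\check H_q(X)$, choose a cochain $\xi$ representing $z$, an open covering $\mathcal U$ such that $\delta\xi$ is $\mathcal U$-locally zero, and a $\mathcal U$-small representative $c=\sum_i k_i\sigma_i$ of $\gamma$. Then $\int_\gamma z:=\xi(c):=\sum_i k_i\,\xi(\sigma_i)$, where $\xi((x_0\ \ldots\ x_q))=\xi(x_0,\ldots,x_q)$; this is independent of the choices and bilinear. *)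

(* Defs.v *)
From HB Require Import structures.
From mathcomp Require Import all_boot all_order all_algebra.
From mathcomp Require Import generic_quotient ring_quotient.
From mathcomp Require Import all_classical topology prodnormedzmodule.
From mathcomp.multinomials Require Import freeg.

Set Implicit Arguments.
Unset Strict Implicit.
Unset Printing Implicit Defensive.

Import GRing.Theory.
Local Open Scope classical_set_scope.
Local Open Scope ring_scope.
Local Open Scope quotient_scope.

(* The library's [submodClosed] is not closed under opposites, hence cannot be
   fed to [Quotient.quot]; [subspace_pred S] is both a [zmodClosed] and a
   [submodClosed]. *)
Record subspace (K : fieldType) (V : lmodType K) := Subspace {
  subspace_set :> V -> Prop;
  subspace0 : subspace_set 0;
  subspace_lin : forall a u v,
    subspace_set u -> subspace_set v -> subspace_set (a *: u + v) }.

Definition subspace_pred (K : fieldType) (V : lmodType K) (S : subspace V)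
  : {pred V} := fun v => `[< S v >].

Fact subspace_pred_closed (K : fieldType) (V : lmodType K) (S : subspace V) :
  subsemimod_closed (subspace_pred S).
Proof.
apply: GRing.submod_closed_semi; split; first exact/asboolP/subspace0.
by move=> a u v /asboolP Pu /asboolP Pv; apply/asboolP/subspace_lin.
Qed.
HB.instance Definition _ (K : fieldType) (V : lmodType K) (S : subspace V) :=
  GRing.isSubmodClosed.Build K V (subspace_pred S) (subspace_pred_closed S).

Lemma subspace_predP (K : fieldType) (V : lmodType K) (S : subspace V) v :
  reflect (S v) (v \in subspace_pred S).
Proof. exact: asboolP. Qed.

Section Submodule.
Variables (K : fieldType) (V : lmodType K) (S : subspace V).

Definition submod := {v : V | v \in subspace_pred S}.
HB.instance Definition _ := [isSub of submod for @sval V (fun v => v \in subspace_pred S)].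
HB.instance Definition _ := [Choice of submod by <:].
HB.instance Definition _ := [SubChoice_isSubLmodule of submod by <:].

End Submodule.

Section QuotientModule.
Variables (K : fieldType) (V : lmodType K) (S : subspace V).

Definition quotmod := Quotient.quot (subspace_pred S).
HB.instance Definition _ := GRing.Zmodule.on quotmod.
Local Notation equivS := (Quotient.equiv (subspace_pred S)).
Local Notation quotS := (Quotient.quot (subspace_pred S)).
HB.instance Definition _ : EqQuotient V equivS quotmod := EqQuotient.on quotmod.
HB.instance Definition _ := isZmodQuotient.Build V equivS 0 -%R +%R quotmod
  (@pi_zeror _ _ _ _ _ quotS) (@pi_oppr _ _ _ _ _ quotS)
  (@pi_addr _ _ _ _ _ quotS).

Definition quotmod_pi (v : V) : quotmod := \pi v.

Lemma quotmod_ind (P : quotmod -> Prop) :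
  (forall v, P (quotmod_pi v)) -> forall x, P x.
Proof. by move=> Ppi x; rewrite -[x]reprK; exact: Ppi. Qed.

Lemma quotmod_piK x : quotmod_pi (repr x) = x.
Proof. exact: reprK. Qed.

Lemma quotmod_piP (u v : V) : quotmod_pi u = quotmod_pi v <-> S (u - v).
Proof.
split=> [/eqP|] uv; last apply/eqP; move: uv;
  rewrite /quotmod_pi -Quotient.idealrBE; last by move/asboolP.
by move/asboolP.
Qed.

Lemma quotmod_piD u v : quotmod_pi u + quotmod_pi v = quotmod_pi (u + v).
Proof. by rewrite /quotmod_pi raddfD. Qed.

Definition quotmod_scale (k : K) (x : quotmod) := quotmod_pi (k *: repr x).

Lemma quotmod_scaleE k v : quotmod_scale k (quotmod_pi v) = quotmod_pi (k *: v).
Proof.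
apply/quotmod_piP; rewrite -scalerBr; apply/asboolP.
apply: (rpredZ k (_ : _ \in subspace_pred S)); apply/asboolP.
by apply/quotmod_piP; rewrite quotmod_piK.
Qed.

Fact quotmod_scaleA a b x :
  quotmod_scale a (quotmod_scale b x) = quotmod_scale (a * b) x.
Proof. by elim/quotmod_ind: x => x; rewrite !quotmod_scaleE scalerA. Qed.

Fact quotmod_scale1 : left_id 1 quotmod_scale.
Proof. by elim/quotmod_ind => x; rewrite quotmod_scaleE scale1r. Qed.

Fact quotmod_scaleDr : right_distributive quotmod_scale +%R.
Proof.
move=> a; elim/quotmod_ind => x; elim/quotmod_ind => y.
by rewrite quotmod_piD !quotmod_scaleE quotmod_piD scalerDr.
Qed.

Fact quotmod_scaleDl x : {morph quotmod_scale^~ x : a b / a + b}.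
Proof.
move=> a b; elim/quotmod_ind: x => x.
by rewrite !quotmod_scaleE quotmod_piD scalerDl.
Qed.

HB.instance Definition _ := GRing.Zmodule_isLmodule.Build K quotmod
  quotmod_scaleA quotmod_scale1 quotmod_scaleDr quotmod_scaleDl.

Fact quotmod_pi_is_linear : linear quotmod_pi.
Proof.
move=> a u v; rewrite -quotmod_piD; congr (_ + _).
by rewrite -quotmod_scaleE.
Qed.
HB.instance Definition _ :=
  GRing.isLinear.Build K V quotmod *:%R quotmod_pi quotmod_pi_is_linear.

Lemma quotmod_pi_eq0 (v : V) : quotmod_pi v = 0 <-> S v.
Proof.
by rewrite -{1}(linear0 quotmod_pi); split=> [/quotmod_piP|Sv];
  [|apply/quotmod_piP]; rewrite subr0.
Qed.

End QuotientModule.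

Section LinearMaps.
Variables (K : fieldType) (V W : lmodType K).

Fact ker_lin (f : {linear V -> W}) a u v :
  f u = 0 -> f v = 0 -> f (a *: u + v) = 0.
Proof. by move=> fu fv; rewrite linearP fu fv scaler0 addr0. Qed.
Definition ker (f : {linear V -> W}) : subspace V :=
  Subspace (linear0 f) (@ker_lin f).

Fact im_0 (f : {linear V -> W}) : exists v, f v = 0.
Proof. by exists 0; rewrite linear0. Qed.
Fact im_lin (f : {linear V -> W}) a u v :
  (exists x, f x = u) -> (exists x, f x = v) -> exists x, f x = a *: u + v.
Proof. by move=> [x <-] [y <-]; exists (a *: x + y); rewrite linearP. Qed.
Definition im (f : {linear V -> W}) : subspace W :=
  Subspace (im_0 f) (@im_lin f).

Variables (S : subspace V) (T : subspace W) (f : {linear V -> W}).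
Hypothesis fST : forall v, S v -> T (f v).

Definition quotmod_map (x : quotmod S) : quotmod T :=
  quotmod_pi T (f (repr x)).

Lemma quotmod_mapE v : quotmod_map (quotmod_pi S v) = quotmod_pi T (f v).
Proof.
apply/quotmod_piP; rewrite -linearB; apply: fST.
by apply/quotmod_piP; rewrite quotmod_piK.
Qed.

Fact quotmod_map_is_linear : linear quotmod_map.
Proof.
move=> a; elim/quotmod_ind => u; elim/quotmod_ind => v.
by rewrite -linearP !quotmod_mapE linearP linearP.
Qed.
End LinearMaps.

Fact trivial_subspace_lin (K : fieldType) (V : lmodType K) (a : K) (u v : V) :
  u = 0 -> v = 0 -> a *: u + v = 0.
Proof. by move=> -> ->; rewrite scaler0 addr0. Qed.
Definition trivial_subspace (K : fieldType) (V : lmodType K) : subspace V :=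
  Subspace (erefl (0 : V)) (@trivial_subspace_lin K V).

Section Subquotient.
Variables (K : fieldType) (V : lmodType K).

Definition in_submod (S : subspace V) v (Sv : S v) : submod S :=
  exist _ v (asboolT Sv).

Lemma submodP (S : subspace V) (x : submod S) : S (val x).
Proof. exact/asboolP/(valP x). Qed.

Variables Z B : subspace V.

Fact subspace_restr_lin a (u v : submod Z) :
  B (val u) -> B (val v) -> B (val (a *: u + v)).
Proof. by move=> Bu Bv; rewrite linearP; apply: subspace_lin. Qed.
Definition subspace_restr : subspace (submod Z) :=
  @Subspace K (submod Z) (fun z => B (val z)) (subspace0 B) subspace_restr_lin.

(* Z / (Z `&` B); in the uses below B is contained in Z. *)
Definition subquot := quotmod subspace_restr.
HB.instance Definition _ := GRing.Lmodule.on subquot.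

Definition subquot_class v (Zv : Z v) : subquot :=
  quotmod_pi subspace_restr (in_submod Zv).

Definition represents (v : V) (x : subquot) :=
  exists Zv : Z v, subquot_class Zv = x.

Lemma subquot_classP u v (Zu : Z u) (Zv : Z v) :
  subquot_class Zu = subquot_class Zv <-> B (u - v).
Proof. exact: quotmod_piP. Qed.

Lemma represents_exists x : exists v, represents v x.
Proof.
elim/quotmod_ind: x => v; exists (val v), (submodP v).
by congr quotmod_pi; apply: val_inj.
Qed.

Lemma represents_mem v x : represents v x -> Z v.
Proof. by case. Qed.

Lemma represents_sub u v x : represents u x -> represents v x -> B (u - v).
Proof. by move=> [Zu <-] [Zv /esym/subquot_classP]. Qed.

Lemma represents_linear a u v x y :
  represents u x -> represents v y -> represents (a *: u + v) (a *: x + y).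
Proof.
move=> [Zu <-] [Zv <-]; exists (subspace_lin a Zu Zv).
rewrite -linearP; congr quotmod_pi; apply: val_inj.
by rewrite linearP.
Qed.

End Subquotient.

Section SubquotientInclusion.
Variables (K : fieldType) (V : lmodType K) (Z B Z' B' : subspace V).
Hypotheses (ZZ' : forall v, Z v -> Z' v) (BB' : forall v, B v -> B' v).

Definition subquot_incl (x : subquot Z B) : subquot Z' B' :=
  subquot_class B' (ZZ' (submodP (repr x))).

Lemma represents_incl v x : represents v x -> represents v (subquot_incl x).
Proof.
move=> [Zv Ex]; exists (ZZ' Zv); apply/subquot_classP/BB'.
rewrite -[v]/(val (in_submod Zv)) -linearB.
have/quotmod_piP // : quotmod_pi (subspace_restr Z B) (in_submod Zv) =
  quotmod_pi (subspace_restr Z B) (repr x).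
by rewrite quotmod_piK.
Qed.

Fact subquot_incl_is_linear : linear subquot_incl.
Proof.
move=> a x y; have [u ux] := represents_exists x.
have [v vy] := represents_exists y.
have [? <-] := represents_incl (represents_linear a ux vy).
have [? <-] := represents_linear a (represents_incl ux) (represents_incl vy).
by apply/subquot_classP; rewrite subrr; apply: subspace0.
Qed.
End SubquotientInclusion.

Section ProductModule.
Variables (K : fieldType) (I : Type) (V : I -> lmodType K).

Definition prodmod := forall i, V i.
HB.instance Definition _ := gen_eqMixin prodmod.
HB.instance Definition _ := gen_choiceMixin prodmod.

Implicit Types f g h : prodmod.
Let add f g : prodmod := fun i => f i + g i.
Let opp f : prodmod := fun i => - f i.
Let zero : prodmod := fun i => 0.
Let scale (k : K) f : prodmod := fun i => k *: f i.

Fact prodmod_addA : associative add.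
Proof. by move=> f g h; apply: functional_extensionality_dep => i;
  apply: addrA. Qed.
Fact prodmod_addC : commutative add.
Proof. by move=> f g; apply: functional_extensionality_dep => i;
  apply: addrC. Qed.
Fact prodmod_add0 : left_id zero add.
Proof. by move=> f; apply: functional_extensionality_dep => i;
  apply: add0r. Qed.
Fact prodmod_addN : left_inverse zero opp add.
Proof. by move=> f; apply: functional_extensionality_dep => i;
  apply: addNr. Qed.
HB.instance Definition _ := GRing.isZmodule.Build prodmod
  prodmod_addA prodmod_addC prodmod_add0 prodmod_addN.

Fact prodmod_scaleA a b f : scale a (scale b f) = scale (a * b) f.
Proof. by apply: functional_extensionality_dep => i;
  apply: scalerA. Qed.
Fact prodmod_scale1 : left_id 1 scale.
Proof. by move=> f; apply: functional_extensionality_dep => i;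
  apply: scale1r. Qed.
Fact prodmod_scaleDr : right_distributive scale +%R.
Proof. by move=> a f g; apply: functional_extensionality_dep => i;
  apply: scalerDr. Qed.
Fact prodmod_scaleDl f : {morph scale^~ f : a b / a + b}.
Proof. by move=> a b; apply: functional_extensionality_dep => i;
  apply: scalerDl. Qed.
HB.instance Definition _ := GRing.Zmodule_isLmodule.Build K prodmod
  prodmod_scaleA prodmod_scale1 prodmod_scaleDr prodmod_scaleDl.

End ProductModule.

Section HomModule.
Variables (K : fieldType) (V W : lmodType K).
Implicit Types f g h : {linear V -> W}.

Lemma linear_ext f g : f =1 g -> f = g.
Proof.
case: f g => f cf [g cg] /= /funext fg; subst g; congr GRing.Linear.Pack.
case: cf cg => [[a] [s]] [[b] [t]].
by rewrite (Prop_irrelevance a b) (Prop_irrelevance s t).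
Qed.

Let add f g : {linear V -> W} := f \+ g.
Let opp f : {linear V -> W} := \- f.
Let zero : {linear V -> W} := \0.
Let scale (k : K) f : {linear V -> W} := k \*: f.

Fact hom_addA : associative add.
Proof. by move=> f g h; apply: linear_ext => v /=; rewrite addrA. Qed.
Fact hom_addC : commutative add.
Proof. by move=> f g; apply: linear_ext => v /=; rewrite addrC. Qed.
Fact hom_add0 : left_id zero add.
Proof. by move=> f; apply: linear_ext => v /=; rewrite add0r. Qed.
Fact hom_addN : left_inverse zero opp add.
Proof. by move=> f; apply: linear_ext => v /=; rewrite addNr. Qed.
HB.instance Definition _ := GRing.isZmodule.Build {linear V -> W}
  hom_addA hom_addC hom_add0 hom_addN.

Fact hom_scaleA a b f : scale a (scale b f) = scale (a * b) f.
Proof. by apply: linear_ext => v /=; rewrite scalerA. Qed.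
Fact hom_scale1 : left_id 1 scale.
Proof. by move=> f; apply: linear_ext => v /=; rewrite scale1r. Qed.
Fact hom_scaleDr : right_distributive scale +%R.
Proof. by move=> a f g; apply: linear_ext => v /=; rewrite scalerDr. Qed.
Fact hom_scaleDl f : {morph scale^~ f : a b / a + b}.
Proof. by move=> a b; apply: linear_ext => v /=; rewrite scalerDl. Qed.
HB.instance Definition _ := GRing.Zmodule_isLmodule.Build K {linear V -> W}
  hom_scaleA hom_scale1 hom_scaleDr hom_scaleDl.

Lemma hom_addE f g v : (f + g) v = f v + g v. Proof. by []. Qed.
Lemma hom_scaleE a f v : (a *: f) v = a *: f v. Proof. by []. Qed.

End HomModule.

Definition finite_dimensional (K : fieldType) (V : lmodType K) :=
  exists (n : nat) (b : 'I_n -> V),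
    forall v, exists k : 'I_n -> K, v = \sum_i k i *: b i.

Section FreegLinear.
Variables (K : fieldType) (T : choiceType) (M : lmodType K).
Implicit Types (f g : T -> M) (c : {freeg T / K}).

HB.instance Definition _ f :=
  GRing.isZmodMorphism.Build {freeg T / K} M (fglift f) (lift_is_additive f).

Lemma fgliftE f c : fglift f c = \sum_(t <- dom c) coeff t c *: f t.
Proof.
rewrite -{1}[c]freeg_sumE raddf_sum; apply: eq_bigr => t _.
by rewrite /= liftU.
Qed.

Fact fglift_is_scalable f : scalable (fglift f).
Proof.
move=> a c; have -> : a *: c = fgscale a c by [].
rewrite /fgscale raddf_sum [in RHS]fgliftE scaler_sumr.
by apply: eq_bigr => t _; rewrite /= liftU scalerA.
Qed.
HB.instance Definition _ f :=
  GRing.isScalable.Build K {freeg T / K} M *:%R (fglift f)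
    (fglift_is_scalable f).

Lemma fglift_linl a f g c :
  fglift (a *: f + g) c = a *: fglift f c + fglift g c.
Proof.
rewrite !fgliftE scaler_sumr -big_split; apply: eq_bigr => t _ /=.
by rewrite scalerDr !scalerA mulrC.
Qed.

End FreegLinear.

Lemma fglift_comp (K : fieldType) (T : choiceType) (M N : lmodType K)
    (f : T -> M) (h : {linear M -> N}) (c : {freeg T / K}) :
  h (fglift f c) = fglift (h \o f) c.
Proof.
by rewrite !fgliftE linear_sum; apply: eq_bigr => t _; rewrite linearZ.
Qed.

Record open_cover (X : topologicalType) := OpenCover {
  cover_sets :> set (set X);
  cover_open : forall A, cover_sets A -> open A;
  cover_setT : \bigcup_(A in cover_sets) A = [set: X] }.

(* [refines V U]: V is finer than U *)
Definition refines (X : topologicalType) (V U : open_cover X) :=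
  forall A, cover_sets V A -> exists2 B, cover_sets U B & A `<=` B.

Section CommonRefinement.
Variables (X : topologicalType) (U V : open_cover X).

Definition meet_sets : set (set X) :=
  [set C | exists A B, [/\ cover_sets U A, cover_sets V B & C = A `&` B]].

Fact meet_open C : meet_sets C -> open C.
Proof.
by move=> [A [B [/cover_open oA /cover_open oB ->]]]; exact: openI.
Qed.

Fact meet_setT : \bigcup_(C in meet_sets) C = [set: X].
Proof.
rewrite -subTset => x _.
have [A UA Ax] : (\bigcup_(A in cover_sets U) A) x by rewrite cover_setT.
have [B VB Bx] : (\bigcup_(A in cover_sets V) A) x by rewrite cover_setT.
by exists (A `&` B) => //; exists A, B.
Qed.

Definition meet_cover := OpenCover meet_open meet_setT.

Lemma refines_meetl : refines meet_cover U.
Proof. by move=> C [A [B [UA _ ->]]]; exists A => // x []. Qed.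

Lemma refines_meetr : refines meet_cover V.
Proof. by move=> C [A [B [_ VB ->]]]; exists B => // x []. Qed.

End CommonRefinement.

Section Simplices.
Variable X : topologicalType.

Definition simplex (q : nat) := q.+1.-tuple X.
HB.instance Definition _ q := Choice.on (simplex q).

(* [fintype.lift j] skips the index j. *)
Definition face q (j : 'I_q.+2) (s : simplex q.+1) : simplex q :=
  [tuple tnth s (fintype.lift j i) | i < q.+1].

Definition small (U : open_cover X) q (s : simplex q) :=
  exists2 A, cover_sets U A & forall i, A (tnth s i).

Lemma small_face U q j (s : simplex q.+1) : small U s -> small U (face j s).
Proof. by move=> [A UA As]; exists A => // i; rewrite tnth_mktuple. Qed.

Lemma small_refines V U q (s : simplex q) : refines V U -> small V s -> small U s.
Proof. by move=> VU [A /VU[B UB AB] As]; exists B => // i; exact/AB. Qed.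

End Simplices.

Section Chains.
Variables (X : topologicalType) (K : fieldType).

Definition chain (q : nat) := {freeg (simplex X q) / K}.
HB.instance Definition _ q := GRing.Lmodule.on (chain q).

Definition boundary q : chain q.+1 -> chain q :=
  fglift (fun s => \sum_(j < q.+2) (-1) ^+ j *: << face j s >>).
HB.instance Definition _ q := GRing.Linear.on (@boundary q).

(* The chain complex is not augmented: every 0-chain is a cycle. *)
Definition is_cycle q : chain q -> Prop :=
  match q with 0 => fun=> True | q'.+1 => fun c => boundary c = 0 end.

Definition small_chain (U : open_cover X) q (c : chain q) :=
  forall s, s \in dom c -> small U s.

Lemma is_cycle_lin q a (b c : chain q) :
  is_cycle b -> is_cycle c -> is_cycle (a *: b + c).
Proof.
case: q b c => //= q b c; exact: (ker_lin (f := @boundary q)).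
Qed.

Lemma is_cycle0 q : is_cycle (0 : chain q).
Proof. by case: q => //= q; rewrite linear0. Qed.

Lemma small_chain0 U q : small_chain U (0 : chain q).
Proof. by move=> s; rewrite dom0. Qed.

Lemma small_chain_lin U q a (b c : chain q) :
  small_chain U b -> small_chain U c -> small_chain U (a *: b + c).
Proof.
move=> Ub Uc s /domD_subset; rewrite mem_cat => /orP[/domZ_subset|].
  exact: Ub.
exact: Uc.
Qed.

Lemma small_chain_refines V U q (c : chain q) :
  refines V U -> small_chain V c -> small_chain U c.
Proof. by move=> VU Vc s /Vc; exact: small_refines. Qed.

Section Homology.
Variables (U : open_cover X) (q : nat).

Fact cycles_lin a (b c : chain q) :
  small_chain U b /\ is_cycle b -> small_chain U c /\ is_cycle c ->
  small_chain U (a *: b + c) /\ is_cycle (a *: b + c).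
Proof.
move=> [Ub Zb] [Uc Zc].
by split; [exact: small_chain_lin | exact: is_cycle_lin].
Qed.
Definition cycles : subspace (chain q) :=
  Subspace (conj (@small_chain0 U q) (is_cycle0 q)) cycles_lin.

Fact boundaries0 : exists2 b : chain q.+1, small_chain U b & boundary b = 0.
Proof. by exists 0; [exact: small_chain0 | rewrite linear0]. Qed.
Fact boundaries_lin a (u v : chain q) :
  (exists2 b, small_chain U b & boundary b = u) ->
  (exists2 b, small_chain U b & boundary b = v) ->
  exists2 b, small_chain U b & boundary b = a *: u + v.
Proof.
move=> [b Ub <-] [c Uc <-]; exists (a *: b + c); first exact: small_chain_lin.
exact: linearP.
Qed.
Definition boundaries : subspace (chain q) := Subspace boundaries0 boundaries_lin.

Definition homology := subquot cycles boundaries.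
HB.instance Definition _ := GRing.Lmodule.on homology.

End Homology.

Section HomologyMap.
Variables (V U : open_cover X) (VU : refines V U) (q : nat).

Fact cycles_refines (c : chain q) : cycles V q c -> cycles U q c.
Proof. by move=> [Vc Zc]; split=> //; exact: small_chain_refines Vc. Qed.
Fact boundaries_refines (c : chain q) : boundaries V q c -> boundaries U q c.
Proof. by move=> [b Vb <-]; exists b => //; exact: small_chain_refines Vb. Qed.

Definition homology_map : homology V q -> homology U q :=
  @subquot_incl K (chain q) _ _ _ _ cycles_refines.
HB.instance Definition _ :=
  GRing.isLinear.Build K (homology V q) (homology U q) *:%R homology_map
    (subquot_incl_is_linear cycles_refines boundaries_refines).

End HomologyMap.

Section CechHomology.
Variable q : nat.

Fact coherent_lin a (f g : prodmod (fun U : open_cover X => homology U q)) :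
  (forall V U (VU : refines V U), homology_map VU (f V) = f U) ->
  (forall V U (VU : refines V U), homology_map VU (g V) = g U) ->
  forall V U (VU : refines V U), homology_map VU ((a *: f + g) V) = (a *: f + g) U.
Proof.
move=> cf cg V U VU; rewrite -[(a *: f + g) U]/(a *: f U + g U) -(cf _ _ VU).
by rewrite -(cg _ _ VU) -linearP.
Qed.
Fact coherent0 V U (VU : refines V U) : homology_map VU (0 : homology V q) = 0.
Proof. exact: linear0. Qed.
Definition coherent : subspace (prodmod (fun U : open_cover X => homology U q)) :=
  @Subspace K (prodmod (fun U : open_cover X => homology U q))
    (fun f => forall V U (VU : refines V U), homology_map VU (f V) = f U)
    coherent0 coherent_lin.

(* The inverse limit, over the open covers ordered by refinement. *)
Definition cech_homology := submod coherent.
HB.instance Definition _ := GRing.Lmodule.on cech_homology.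

Definition component (gamma : cech_homology) (U : open_cover X) : homology U q :=
  val gamma U.

Definition representative (U : open_cover X) (c : chain q) (gamma : cech_homology) :=
  represents c (component gamma U).

End CechHomology.
End Chains.

Section Cochains.
Variables (X : topologicalType) (K : fieldType).

Definition cochain (q : nat) := simplex X q -> K^o.
HB.instance Definition _ q := GRing.Lmodule.on (cochain q).

Definition coboundary q (xi : cochain q) : cochain q.+1 :=
  fun s => \sum_(j < q.+2) (-1) ^+ j * xi (face j s).

Fact coboundary_is_linear q : linear (@coboundary q).
Proof.
move=> a xi eta; apply/funext => s; rewrite /coboundary.
rewrite !fctE scaler_sumr -big_split; apply: eq_bigr => j _ /=.
by rewrite mulrDr /GRing.scale /= mulrCA.
Qed.
HB.instance Definition _ q :=
  GRing.isLinear.Build K (cochain q) (cochain q.+1) *:%R (@coboundary q)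
    (@coboundary_is_linear q).

Definition zero_on (U : open_cover X) q (xi : cochain q) :=
  forall s, small U s -> xi s = 0.

Definition is_locally_zero q (xi : cochain q) := exists U, zero_on U xi.

Lemma zero_on_lin U q a (xi eta : cochain q) :
  zero_on U xi -> zero_on U eta -> zero_on U (a *: xi + eta).
Proof.
move=> Uxi Ueta s Us; rewrite !fctE Uxi // Ueta //.
by rewrite scaler0 addr0.
Qed.

Lemma zero_on_refines V U q (xi : cochain q) :
  refines V U -> zero_on U xi -> zero_on V xi.
Proof. by move=> VU Uxi s /(small_refines VU); exact: Uxi. Qed.

Lemma zero_on_coboundary U q (xi : cochain q) :
  zero_on U xi -> zero_on U (coboundary xi).
Proof.
move=> Uxi s Us; rewrite /coboundary big1 // => j _.
by rewrite Uxi ?mulr0 //; exact: small_face.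
Qed.

Fact setT_cover_proof :
  \bigcup_(A in [set [set: X]]) A = [set: X].
Proof. by rewrite bigcup_set1. Qed.
Fact setT_cover_open (A : set X) : [set [set: X]] A -> open A.
Proof. by move=> ->; exact: openT. Qed.
Definition setT_cover : open_cover X := OpenCover setT_cover_open setT_cover_proof.

Fact locally_zero0 q : is_locally_zero (0 : cochain q).
Proof. by exists setT_cover. Qed.
Fact locally_zero_lin q a (xi eta : cochain q) :
  is_locally_zero xi -> is_locally_zero eta -> is_locally_zero (a *: xi + eta).
Proof.
move=> [U Uxi] [V Veta]; exists (meet_cover U V); apply: zero_on_lin.
  exact: zero_on_refines (@refines_meetl _ U V) Uxi.
exact: zero_on_refines (@refines_meetr _ U V) Veta.
Qed.
Definition locally_zero q : subspace (cochain q) :=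
  Subspace (locally_zero0 q) (@locally_zero_lin q).

Lemma locally_zero_coboundary q (xi : cochain q) :
  locally_zero q xi -> locally_zero q.+1 (coboundary xi).
Proof. by move=> [U Uxi]; exists U; exact: zero_on_coboundary. Qed.

(* The Alexander-Spanier complex: cochains modulo locally zero ones. *)
Definition as_cochain (q : nat) := quotmod (locally_zero q).
HB.instance Definition _ q := GRing.Lmodule.on (as_cochain q).

Definition as_coboundary q : as_cochain q -> as_cochain q.+1 :=
  @quotmod_map K _ _ (locally_zero q) (locally_zero q.+1) (@coboundary q).
HB.instance Definition _ q :=
  GRing.isLinear.Build K (as_cochain q) (as_cochain q.+1) *:%R
    (@as_coboundary q) (quotmod_map_is_linear (@locally_zero_coboundary q)).

Definition as_coboundaries q : subspace (as_cochain q) :=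
  match q with 0 => trivial_subspace _ | q'.+1 => im (@as_coboundary q') end.

(* Cech cohomology in its Alexander-Spanier form. *)
Definition cech_cohomology (q : nat) :=
  subquot (ker (@as_coboundary q)) (as_coboundaries q).
HB.instance Definition _ q := GRing.Lmodule.on (cech_cohomology q).

Definition cochain_represents q (xi : cochain q) (z : cech_cohomology q) :=
  represents (quotmod_pi (locally_zero q) xi) z.

End Cochains.

Section Integral.
Variables (X : topologicalType) (K : fieldType).

Definition eval q (xi : cochain X K q) (c : chain X K q) : K^o := fglift xi c.

Fact eval_is_linear q (xi : cochain X K q) : linear (eval xi).
Proof. by move=> a b c; rewrite /eval linearP. Qed.
HB.instance Definition _ q (xi : cochain X K q) :=
  GRing.isLinear.Build K (chain X K q) K^o *:%R (eval xi) (eval_is_linear xi).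

Lemma evalE q (xi : cochain X K q) (c : chain X K q) :
  eval xi c = \sum_(s <- dom c) coeff s c * xi s.
Proof. exact: fgliftE. Qed.

Lemma eval_linl q a (xi eta : cochain X K q) c :
  eval (a *: xi + eta) c = a *: eval xi c + eval eta c.
Proof. exact: fglift_linl. Qed.

Lemma eval_boundary q (xi : cochain X K q) (c : chain X K q.+1) :
  eval xi (boundary c) = eval (coboundary xi) c.
Proof.
rewrite /eval /boundary (fglift_comp _ (fglift xi : {linear chain X K q -> K^o})).
congr (fglift _ c); apply/funext => s /=; rewrite linear_sum.
by apply: eq_bigr => j _; rewrite linearZ /= liftU scale1r.
Qed.

Lemma eval_zero_on U q (xi : cochain X K q) c :
  zero_on U xi -> small_chain U c -> eval xi c = 0.
Proof.
move=> Uxi Uc; rewrite evalE big_seq big1 // => s /Uc /Uxi ->.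
exact: mulr0.
Qed.

Variable q : nat.
Implicit Types (xi : cochain X K q) (c : chain X K q) (U V : open_cover X).
Implicit Types (z : cech_cohomology X K q) (gamma : cech_homology X K q).

Definition integral_spec gamma z : set K^o := fun k =>
  exists xi U c, [/\ cochain_represents xi z, zero_on U (coboundary xi),
    representative U c gamma & k = eval xi c].

(* The value is independent of the choices, see [integralE]. *)
Definition integral gamma z : K^o := xget 0 (integral_spec gamma z).

Lemma cochain_exists z :
  exists xi U, cochain_represents xi z /\ zero_on U (coboundary xi).
Proof.
have [x xz] := represents_exists z; elim/quotmod_ind: x xz => xi xiz.
have := represents_mem xiz; rewrite /= /as_coboundary quotmod_mapE; last first.
  exact: locally_zero_coboundary.
by move=> /quotmod_pi_eq0[U Uxi]; exists xi, U.
Qed.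

Lemma representative_exists gamma U : exists c, representative U c gamma.
Proof. exact: represents_exists. Qed.

Lemma representative_refines V U c gamma :
  refines V U -> representative V c gamma -> representative U c gamma.
Proof.
move=> VU Vc; rewrite /representative /component -(submodP gamma _ _ VU).
exact: (represents_incl (cycles_refines VU (q := q))
  (boundaries_refines VU (q := q))) Vc.
Qed.

Lemma eval_representative U xi b c gamma : zero_on U (coboundary xi) ->
  representative U b gamma -> representative U c gamma -> eval xi b = eval xi c.
Proof.
move=> Uxi Ub Uc; have [a Ua ab] := represents_sub Ub Uc.
have /eqP : eval xi (boundary a) = 0.
  by rewrite eval_boundary; exact: eval_zero_on Ua.
by rewrite ab linearB subr_eq0 => /eqP.
Qed.

Lemma as_coboundaryE k (xi : cochain X K k) :
  as_coboundary (quotmod_pi (locally_zero X K k) xi) =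
  quotmod_pi (locally_zero X K k.+1) (coboundary xi).
Proof. exact: (quotmod_mapE (@locally_zero_coboundary X K k)). Qed.

Lemma eval_as_coboundaries xi :
  as_coboundaries X K q (quotmod_pi (locally_zero X K q) xi) ->
  exists U, forall c, cycles K U q c -> eval xi c = 0.
Proof.
case: (q) xi => [|k] xi /=.
  by move=> /quotmod_pi_eq0[U Uxi]; exists U => c [Uc _]; exact: eval_zero_on Uc.
move=> [x]; elim/quotmod_ind: x => eta; rewrite as_coboundaryE.
move=> /quotmod_piP[U Uxi]; exists U => c [Uc /= Zc].
have /eqP := eval_zero_on Uxi Uc; rewrite -[coboundary eta]scale1r -scaleN1r.
rewrite addrC eval_linl scale1r -eval_boundary Zc linear0 addr0.
by rewrite scaler_eq0 oppr_eq0 oner_eq0 => /eqP.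
Qed.

Lemma eval_cochain_represents xi eta z :
  cochain_represents xi z -> cochain_represents eta z ->
  exists U, forall c, cycles K U q c -> eval xi c = eval eta c.
Proof.
move=> xiz etaz; have := represents_sub xiz etaz; rewrite -linearB.
move=> /eval_as_coboundaries[U UP]; exists U => c Uc.
have /eqP := UP c Uc; rewrite addrC -scaleN1r eval_linl.
by rewrite scaleN1r addrC subr_eq0 => /eqP.
Qed.

Lemma integral_spec_unique gamma z k k' :
  integral_spec gamma z k -> integral_spec gamma z k' -> k = k'.
Proof.
move=> [xi [U [c [xiz Uxi Uc ->]]]] [xi' [U' [c' [xiz' Uxi' Uc' ->]]]].
have [W WP] := eval_cochain_represents xiz xiz'.
pose V := meet_cover W (meet_cover U U').
have [b Vb] := representative_exists gamma V.
have rep_b T : refines V T -> representative T b gamma.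
  by move=> VT; exact: representative_refines Vb.
have VUU' := @refines_meetr _ W (meet_cover U U').
have trans T T' T'' : @refines X T T' -> refines T' T'' -> refines T T''.
  move=> TT' TT'' A /TT'[B /TT''[C ? BC] AB]; exists C => //.
  exact: subset_trans BC.
rewrite (eval_representative Uxi Uc (rep_b U _)); last first.
  exact: trans VUU' (@refines_meetl _ U U').
rewrite (eval_representative Uxi' Uc' (rep_b U' _)); last first.
  exact: trans VUU' (@refines_meetr _ U U').
apply: WP; apply: represents_mem (rep_b W _).
exact: refines_meetl.
Qed.

Lemma integralE gamma z xi U c : cochain_represents xi z ->
  zero_on U (coboundary xi) -> representative U c gamma ->
  integral gamma z = eval xi c.
Proof.
move=> xiz Uxi Uc.
have spec : integral_spec gamma z (eval xi c) by exists xi, U, c.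
exact: integral_spec_unique (xgetI 0 spec) spec.
Qed.

Lemma representative_linear a U b c beta gamma :
  representative U b beta -> representative U c gamma ->
  representative U (a *: b + c) (a *: beta + gamma).
Proof. exact: represents_linear. Qed.

Lemma cochain_represents_linear a xi eta y z :
  cochain_represents xi y -> cochain_represents eta z ->
  cochain_represents (a *: xi + eta) (a *: y + z).
Proof.
move=> xiy etaz; rewrite /cochain_represents linearP.
exact: represents_linear.
Qed.

Fact integral_linr gamma : linear (integral gamma).
Proof.
move=> a y z; have [xi [U [xiy Uxi]]] := cochain_exists y.
have [eta [V [etaz Veta]]] := cochain_exists z.
pose W := meet_cover U V.
have WUxi := zero_on_refines (@refines_meetl _ U V) Uxi.
have WVeta := zero_on_refines (@refines_meetr _ U V) Veta.
have [c Wc] := representative_exists gamma W.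
rewrite (integralE xiy WUxi Wc) (integralE etaz WVeta Wc) -eval_linl.
apply: integralE (cochain_represents_linear a xiy etaz) _ Wc.
by rewrite linearP; exact: zero_on_lin.
Qed.
HB.instance Definition _ gamma :=
  GRing.isLinear.Build K (cech_cohomology X K q) K^o *:%R (integral gamma)
    (integral_linr gamma).

Fact integral_linl z : linear (integral^~ z).
Proof.
move=> a beta gamma; have [xi [U [xiz Uxi]]] := cochain_exists z.
have [b Ub] := representative_exists beta U.
have [c Uc] := representative_exists gamma U.
rewrite (integralE xiz Uxi Ub) (integralE xiz Uxi Uc) -linearP.
exact: integralE xiz Uxi (representative_linear a Ub Uc).
Qed.

Definition integral_against z gamma := integral gamma z.
HB.instance Definition _ z :=
  GRing.isLinear.Build K (cech_homology X K q) K^o *:%R (integral_against z)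
    (integral_linl z).

Definition homology_to_dual gamma : {linear cech_cohomology X K q -> K^o} :=
  integral gamma.

Fact homology_to_dual_is_linear : linear homology_to_dual.
Proof.
by move=> a beta gamma; apply: linear_ext => z; exact: (integral_linl z).
Qed.
HB.instance Definition _ :=
  GRing.isLinear.Build K (cech_homology X K q)
    {linear cech_cohomology X K q -> K^o} *:%R homology_to_dual
    homology_to_dual_is_linear.

Definition cohomology_to_dual z : {linear cech_homology X K q -> K^o} :=
  integral_against z.

Fact cohomology_to_dual_is_linear : linear cohomology_to_dual.
Proof.
by move=> a y z; apply: linear_ext => gamma; exact: (integral_linr gamma).
Qed.
HB.instance Definition _ :=
  GRing.isLinear.Build K (cech_cohomology X K q)
    {linear cech_homology X K q -> K^o} *:%R cohomology_to_dual
    cohomology_to_dual_is_linear.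

End Integral.

(* Main.v *)
Require Import Defs.
From HB Require Import structures.
From mathcomp Require Import all_boot all_order all_algebra.
From mathcomp Require Import finmap.
From mathcomp Require Import all_classical topology.
From mathcomp.multinomials Require Import freeg.

Set Implicit Arguments.
Unset Strict Implicit.
Unset Printing Implicit Defensive.

Import GRing.Theory.
Local Open Scope classical_set_scope.
Local Open Scope ring_scope.

(** The integral pairs Cech homology [H] with Cech cohomology [C]. Everything
    about [C -> Hom(H, K)] is formal once [H -> Hom(C, K)] is known to be
    bijective: over a field, functionals separate points, so a class [z] killed
    by all of [H] is killed by every functional on [C], hence zero; and if one
    side is finite dimensional, finitely many elements of it are enough to embed
    the other side in a power of [K] ([pairing_injective],
    [finite_dimensional_left], [finite_dimensional_right],
    [pairing_surjective]).

    For the bijectivity, cochains are regarded as functionals on chains. A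
    U-small cycle which is not the boundary of a U-small chain is separated from
    those boundaries by a functional, and a functional that kills the boundaries
    of U-small chains is a cochain whose coboundary vanishes on U-small
    simplices ([boundaries_detect]); this gives injectivity. Dually, such a
    cochain that kills the U-small cycles is a coboundary up to a locally zero
    cochain, because its values on [b] depend only on the boundary of [b] and so
    define a functional that extends to all chains
    ([cocycle_vanishing_on_cycles]).

    For surjectivity, let [phi] be a functional on [C]. For each open cover [U]
    we look for a U-small cycle [c] with xi(c) = phi [xi] for every cochain
    [xi] whose coboundary vanishes on U-small simplices. By
    [boundaries_detect] such a [c] is unique up to boundaries of U-small
    chains, so that the classes found for different covers are automatically
    coherent. A [c] found for a cover serves for all coarser ones, so by
    compactness only finite covers matter. When [U] is finite, [X] has only
    finitely many classes of points that lie in the same members of [U], and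
    moving each point to a chosen representative of its class is chain homotopic
    to the identity through U-small chains. Hence every U-small cycle is
    homologous to one on finitely many simplices ([homology_spanned]), the
    functional [phi] depends on the values of [xi] on finitely many cycles only,
    and it is a linear combination of these values, which gives [c]
    ([realizes_finite]). *)

(** * Functionals on vector spaces *)

Section Separation.
Variables (K : fieldType) (V : lmodType K).

Let lin_closed (M : set V) := forall a u v, M u -> M v -> M (a *: u + v).

(** A maximal subspace [M] avoiding [e] is a complement of the line through
    [e]: for [v] outside [M], the space [M + K v] contains [e]. *)
Lemma maximal_subspace_avoiding (B : Defs.subspace V) (e : V) : ~ B e ->
  exists M : Defs.subspace V,
    [/\ forall v, B v -> M v, ~ M e & forall v, exists a, M (v - a *: e)].
Proof.
move=> nBe.
(* The union with [B] lets the empty chain be bounded by the empty set. *)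
pose P (A : set V) := lin_closed (A `|` B) /\ ~ (A `|` B) e.
have chainP F : F `<=` P -> total_on F subset -> P (\bigcup_(A in F) A).
  move=> FP totF; split; last by case=> // -[A /FP[_ nAe] Ae]; apply: nAe; left.
  have bigcupU A u : F A -> (A `|` B) u -> (\bigcup_(A in F) A `|` B) u.
    by move=> FA [Au|Bu]; [left; exists A|right].
  move=> a u v [[A FA Au]|Bu] [[A' FA' Av]|Bv].
  - have [AA'|A'A] := totF _ _ FA FA'.
      by apply: (bigcupU _ _ FA'); apply: (FP _ FA').1; left=> //; exact: AA'.
    by apply: (bigcupU _ _ FA); apply: (FP _ FA).1; left=> //; exact: A'A.
  - by apply: (bigcupU _ _ FA); apply: (FP _ FA).1; [left|right].
  - by apply: (bigcupU _ _ FA'); apply: (FP _ FA').1; [right|left].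
  - by right; exact: subspace_lin.
have [A [[Alin nAe] Amax]] := Zorn_bigcup chainP.
pose M := @Subspace K V (A `|` B) (or_intror (subspace0 B)) Alin.
exists M; split=> // [v Bv|v]; first by right.
have [Mv|nMv] := pselect (M v); first by exists 0; rewrite scale0r subr0.
pose N : set V := [set w | exists a, M (w - a *: v)].
have MN w : M w -> N w by move=> Mw; exists 0; rewrite scale0r subr0.
have Nlin : lin_closed N.
  move=> c u w [a Ma] [b Mb]; exists (c * a + b).
  have -> : c *: u + w - (c * a + b) *: v = c *: (u - a *: v) + (w - b *: v).
    by rewrite scalerBr scalerA scalerDl opprD addrACA.
  exact: subspace_lin.
have NB : N `|` B = N by apply/setUidPl => w Bw; apply: MN; right.
have Ne : N e.
  apply: contrapT => nNe; apply: (Amax N); last by split; rewrite NB.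
  rewrite properEneq; split=> [|w Aw]; last by apply: MN; left.
  apply/eqP => AN; apply: nMv; left; rewrite AN; exists 1.
  by rewrite scale1r subrr; exact: subspace0.
have [a Ma] := Ne; have a_neq0 : a != 0.
  by apply/eqP => a0; apply: nAe; move: Ma; rewrite a0 scale0r subr0.
exists a^-1; have := subspace_lin (- a^-1) Ma (subspace0 M).
by rewrite addr0 scaleNr scalerBr scalerA mulVf // scale1r opprB.
Qed.

Lemma separation (B : Defs.subspace V) (e : V) : ~ B e ->
  exists g : {linear V -> K^o}, (forall v, B v -> g v = 0) /\ g e = 1.
Proof.
move=> /maximal_subspace_avoiding[M [BM nMe /choice[g gP]]].
have coef_unique v a b : M (v - a *: e) -> M (v - b *: e) -> a = b.
  move=> Ma Mb; apply: contrapT => /eqP; rewrite -subr_eq0 => ab.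
  have := subspace_lin (-1) Ma Mb; rewrite scaleN1r opprB addrA subrK -scalerBl.
  move=> Mab; apply: nMe; have := subspace_lin (a - b)^-1 Mab (subspace0 M).
  by rewrite addr0 scalerA mulVf // scale1r.
have g_lin : linear (g : V -> K^o).
  move=> a u v; apply: coef_unique (gP _) _.
  have -> : a *: u + v - (a *: (g u : K^o) + g v) *: e =
      a *: (u - g u *: e) + (v - g v *: e).
    by rewrite scalerBr scalerA scalerDl opprD addrACA.
  exact: subspace_lin.
pose g' : {linear V -> K^o} := HB.pack (g : V -> K^o)
  (GRing.isLinear.Build K V K^o *:%R (g : V -> K^o) g_lin).
exists g'; split=> [v Bv|]; apply: coef_unique (gP _) _.
  by rewrite scale0r subr0; exact: BM.
by rewrite scale1r subrr; exact: subspace0.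
Qed.

(** The map sending [v] to the combination of the [e i] with coefficients
    [f i v] plays the part of a projection of [G] along the joint kernel of the
    [f i], although the [f i] may be linearly dependent. The induction on [n]
    passes to the kernel of [f ord0] in [G]: if that is not all of [G], a vector
    [v0] with [f ord0 v0 = 1], corrected by the [e i] already found, is added to
    them. *)
Lemma dual_system n (f : 'I_n -> {linear V -> K^o}) (G : Defs.subspace V) :
  exists e : 'I_n -> V, (forall i, G (e i)) /\
    forall v, G v -> forall i, f i (v - \sum_j f j v *: e j) = 0.
Proof.
elim: n => [|n IHn] in f G *.
  by exists (fun=> 0); split=> [[]|v _ []].
have G'_lin a u v : G u /\ f ord0 u = 0 -> G v /\ f ord0 v = 0 ->
    G (a *: u + v) /\ f ord0 (a *: u + v) = 0.
  by move=> [Gu fu] [Gv fv]; split; [exact: subspace_lin|exact: ker_lin].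
pose G' := Subspace (conj (subspace0 G) (linear0 (f ord0))) G'_lin.
have [e [G'e ker_e]] := IHn (fun i => f (fintype.lift ord0 i)) G'.
pose consE x i := if unlift ord0 i is Some j then e j else x : V.
have consE0 x : consE x ord0 = x by rewrite /consE unlift_none.
have consES x j : consE x (fintype.lift ord0 j) = e j by rewrite /consE liftK.
have [f0|nf0] := pselect (forall v, G v -> f ord0 v = 0).
  exists (consE 0); split=> [i|v Gv i].
    case: (unliftP ord0 i) => [j|] ->; rewrite ?consE0 ?consES.
      exact: (G'e j).1.
    exact: subspace0.
  rewrite big_ord_recl consE0 scaler0 add0r.
  under eq_bigr do rewrite consES.
  have G'v : G' v by split=> //; exact: f0.
  case: (unliftP ord0 i) => [j|] ->; first exact: ker_e.
  rewrite linearB linear_sum G'v.2 sub0r big1 ?oppr0 // => j _.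
  by rewrite linearZ (G'e j).2; exact: mulr0.
move/existsNP: nf0 => [v1 /not_implyP[Gv1 /eqP fv1]].
pose v0 := (f ord0 v1 : K)^-1 *: v1.
have Gv0 : G v0 by rewrite -[v0]addr0; exact: subspace_lin (subspace0 G).
have fv0 : f ord0 v0 = 1 by rewrite linearZ; exact: mulVf.
pose e0 := v0 - \sum_j f (fintype.lift ord0 j) v0 *: e j.
have Gsum (k : 'I_n -> K) : G (\sum_j k j *: e j).
  elim/big_rec: _ => [|j x _ Gx]; first exact: subspace0.
  by apply: subspace_lin Gx; exact: (G'e j).1.
exists (consE e0); split=> [i|v Gv i].
  case: (unliftP ord0 i) => [j|] ->; rewrite ?consE0 ?consES.
    exact: (G'e j).1.
  by rewrite /e0 addrC -scaleN1r; apply: subspace_lin.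
rewrite big_ord_recl consE0; under eq_bigr do rewrite consES.
pose v' := v - f ord0 v *: v0.
have G'v' : G' v'.
  split; last by rewrite linearB linearZ fv0 /= [_ *: _]mulr1 subrr.
  by rewrite /v' addrC -scaleNr; exact: subspace_lin.
have -> : v - (f ord0 v *: e0 + \sum_j f (fintype.lift ord0 j) v *: e j) =
    v' - \sum_j f (fintype.lift ord0 j) v' *: e j.
  rewrite /v' /e0 scalerBr.
  under [in RHS]eq_bigr do rewrite linearB linearZ /= scalerBl -scalerA.
  rewrite sumrB -scaler_sumr !opprD !opprK !addrA.
  by rewrite [LHS]addrAC.
case: (unliftP ord0 i) => [j|] ->; first exact: ker_e.
rewrite linearB linear_sum G'v'.2 sub0r big1 ?oppr0 // => j _.
by rewrite linearZ (G'e j).2; exact: mulr0.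
Qed.

Lemma spanned_of_joint_kernel n (f : 'I_n -> {linear V -> K^o})
    (G : Defs.subspace V) :
  (forall v, G v -> (forall i, f i v = 0) -> v = 0) ->
  exists e : 'I_n -> V, (forall i, G (e i)) /\
    forall v, G v -> exists k : 'I_n -> K, v = \sum_i k i *: e i.
Proof.
move=> kerf; have [e [Ge fe]] := dual_system f G.
exists e; split=> // v Gv; exists (f^~ v); apply/eqP; rewrite -subr_eq0.
apply/eqP/kerf; last exact: fe.
rewrite addrC -scaleN1r; apply: subspace_lin => //.
elim/big_rec: _ => [|j x _ Gx]; first exact: subspace0.
exact: subspace_lin.
Qed.

Lemma combination_of_joint_kernel n (f : 'I_n -> {linear V -> K^o})
    (g : {linear V -> K^o}) (G : Defs.subspace V) :
  (forall v, G v -> (forall i, f i v = 0) -> g v = 0) ->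
  exists k : 'I_n -> K, forall v, G v -> g v = \sum_i k i * f i v.
Proof.
move=> kerf; have [e [Ge fe]] := dual_system f G.
exists (fun i => g (e i)) => v Gv.
have Gw : G (v - \sum_j f j v *: e j).
  rewrite addrC -scaleN1r; apply: subspace_lin => //.
  elim/big_rec: _ => [|j x _ Gx]; first exact: subspace0.
  exact: subspace_lin.
have /eqP := kerf _ Gw (fe _ Gv).
rewrite linearB subr_eq0 => /eqP ->; rewrite linear_sum.
by apply: eq_bigr => j _; rewrite linearZ [LHS]mulrC.
Qed.

End Separation.

Section Extension.
Variables (K : fieldType) (V W : lmodType K).

(** The functional on the image of [S] that is induced by [f] extends to all of
    [W]. Its graph is a subspace of [W * K] which does not contain [(0, 1)], and
    a functional [h] that vanishes on the graph with [h (0, 1) = 1] yields the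
    extension [w |-> - h (w, 0)]. *)
Lemma extension_along (D : {linear V -> W}) (f : {linear V -> K^o})
    (S : Defs.subspace V) :
  (forall v, S v -> D v = 0 -> f v = 0) ->
  exists g : {linear W -> K^o}, forall v, S v -> g (D v) = f v.
Proof.
move=> fD; pose B0 (w : W * K^o) := exists2 v, S v & w = (D v, f v).
have B0_lin a u w : B0 u -> B0 w -> B0 (a *: u + w).
  move=> [x Sx ->] [y Sy ->]; exists (a *: x + y); first exact: subspace_lin.
  by rewrite !linearP.
have B00 : B0 0 by exists 0; [exact: subspace0|rewrite !linear0].
have [|h [hB h1]] := @separation K _ (Defs.Subspace B00 B0_lin) (0, 1).
  by move=> [v Sv [Dv]]; rewrite fD // => /eqP; rewrite oner_eq0.
have g_lin : linear (fun w : W => - h (w, 0) : K^o).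
  move=> a u w; rewrite scalerN -opprD -linearP; congr (- h _).
  by congr (_, _); rewrite /= scaler0 addr0.
pose g : {linear W -> K^o} := HB.pack (fun w : W => - h (w, 0) : K^o)
  (GRing.isLinear.Build K W K^o *:%R (fun w : W => - h (w, 0) : K^o) g_lin).
exists g => v Sv; rewrite /g /=.
apply/eqP; rewrite eq_sym -addr_eq0; apply/eqP.
rewrite -[RHS](hB (D v, f v)); last by exists v.
have -> : (D v, f v) = f v *: (0, 1) + (D v, 0) :> W * K^o.
  by congr (_, _); rewrite /= ?scaler0 ?add0r ?addr0 // [RHS]mulr1.
by rewrite linearP h1 /= [_ *: 1]mulr1.
Qed.

End Extension.

Section Pairing.
Variables (K : fieldType).

Lemma full_subspace (V : lmodType K) : exists G : Defs.subspace V, forall v, G v.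
Proof. by exists (@Subspace K V (fun=> True) I (fun _ _ _ _ _ => I)). Qed.

Lemma finite_dimensional_of_joint_kernel (V : lmodType K) n
    (f : 'I_n -> {linear V -> K^o}) :
  (forall v, (forall i, f i v = 0) -> v = 0) -> finite_dimensional V.
Proof.
move=> kerf; have [G GT] := full_subspace V.
have [v _|e [_ e_span]] := spanned_of_joint_kernel (f := f) (G := G).
  exact: kerf.
by exists n, e => v; exact: e_span.
Qed.

(** In the rest of this section, [L] and [R] are the two maps attached to one
    bilinear pairing between [H] and [C]. *)
Variables (H C : lmodType K).
Variables (L : {linear H -> {linear C -> K^o}}).
Variables (R : {linear C -> {linear H -> K^o}}).
Hypothesis LR : forall h c, R c h = L h c.
Hypotheses (L_inj : injective L) (L_surj : forall phi, exists h, L h = phi).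

(** Some functional would take the value 1 on a nonzero [c], and every
    functional is of the form [L h]. *)
Lemma pairing_nondegenerate c : (forall h, L h c = 0) -> c = 0.
Proof.
move=> Lc; apply: contrapT => c_neq0.
have [phi [_ phic]] := separation (B := trivial_subspace C) c_neq0.
have [h Lh] := L_surj phi.
by move/eqP: (Lc h); rewrite Lh phic oner_eq0.
Qed.

Lemma pairing_nondegenerate_l h : (forall c, L h c = 0) -> h = 0.
Proof. by move=> Lh; apply: L_inj; rewrite linear0; exact: linear_ext. Qed.

Lemma pairing_injective : injective R.
Proof.
move=> c d cd; apply/eqP; rewrite -subr_eq0; apply/eqP/pairing_nondegenerate => h.
by rewrite linearB -!LR cd subrr.
Qed.

Lemma finite_dimensional_left : finite_dimensional C -> finite_dimensional H.
Proof.
move=> [n [e e_span]]; apply: (@finite_dimensional_of_joint_kernel _ n (R \o e)).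
move=> h Rh; apply: pairing_nondegenerate_l => c.
have [k ->] := e_span c; rewrite linear_sum big1 // => i _.
by rewrite linearZ -LR Rh; exact: mulr0.
Qed.

Lemma finite_dimensional_right : finite_dimensional H -> finite_dimensional C.
Proof.
move=> [n [e e_span]]; apply: (@finite_dimensional_of_joint_kernel _ n (L \o e)).
move=> c Lc; apply: pairing_nondegenerate => h.
have [k ->] := e_span h; rewrite -LR linear_sum big1 // => i _.
by rewrite linearZ LR Lc; exact: mulr0.
Qed.

Lemma pairing_surjective :
  finite_dimensional C -> forall psi, exists c, R c = psi.
Proof.
move=> [n [e e_span]] psi; have [G GT] := full_subspace H.
have [h _ Rh|k kP] :=
    combination_of_joint_kernel (f := R \o e) (g := psi) (G := G).
  suff -> : h = 0 by rewrite linear0.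
  apply: pairing_nondegenerate_l => c.
  have [k ->] := e_span c; rewrite linear_sum big1 // => i _.
  by rewrite linearZ -LR Rh; exact: mulr0.
exists (\sum_i k i *: e i); apply: linear_ext => h.
rewrite kP // LR linear_sum; apply: eq_bigr => i _.
by rewrite linearZ -LR.
Qed.

End Pairing.

(** * The prism operator *)

Lemma freeg_linear_ext (K : fieldType) (T : choiceType) (M : lmodType K)
    (f g : {linear {freeg T / K} -> M}) :
  (forall t, f << t >> = g << t >>) -> f =1 g.
Proof.
move=> fg c.
have fgU a t : << a *g t >> = a *: << t >> :> {freeg T / K}.
  by apply/eqP/freeg_eqP => s; rewrite coeffZ !coeffU mul1r.
rewrite -[c]freeg_sumE !linear_sum; apply: eq_bigr => t _.
by rewrite fgU !linearZ fg.
Qed.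

Lemma fglift1 (K : fieldType) (T : choiceType) (M : lmodType K) (f : T -> M) t :
  fglift f (<< t >> : {freeg T / K}) = f t.
Proof. by rewrite liftU scale1r. Qed.

Section Prism.
Variables (X : topologicalType) (K : fieldType).
Local Notation chain := (chain X K).

Definition cone x q : chain q -> chain q.+1 :=
  fglift (fun s : simplex X q => << [tuple of x :: s] : simplex X q.+1 >>).
HB.instance Definition _ x q := GRing.Linear.on (@cone x q).

Definition push (r : X -> X) q : chain q -> chain q :=
  fglift (fun s : simplex X q => << map_tuple r s : simplex X q >>).
HB.instance Definition _ r q := GRing.Linear.on (@push r q).

(** The alternating sum of the (x_0 .. x_j r(x_j) .. r(x_q)), computed by the
    recursion P(x s) = x (r(x) r(s) - P(s)), where a juxtaposed vertex is a cone.
    The recursion turns all the identities below into consequences of the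
    boundary formula for a cone, without any computation on indices of faces. *)
Fixpoint prism_simplex (r : X -> X) q : simplex X q -> chain q.+1 :=
  match q with
  | 0 => fun s => cone (thead s) << map_tuple r s : simplex X 0 >>
  | q'.+1 => fun s => cone (thead s)
      (<< map_tuple r s : simplex X q'.+1 >> -
       prism_simplex r (behead_tuple s))
  end.

Definition prism (r : X -> X) q : chain q -> chain q.+1 :=
  fglift (prism_simplex r (q := q)).
HB.instance Definition _ r q := GRing.Linear.on (@prism r q).

Lemma cone1 x q (s : simplex X q) :
  cone x (<< s >> : chain q) = << [tuple of x :: s] : simplex X q.+1 >>.
Proof. exact: fglift1. Qed.

Lemma push1 r q (s : simplex X q) :
  push r (<< s >> : chain q) = << map_tuple r s : simplex X q >>.
Proof. exact: fglift1. Qed.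

Lemma prism1 r q (s : simplex X q) :
  prism r (<< s >> : chain q) = prism_simplex r s.
Proof. exact: fglift1. Qed.

Lemma boundary1 q (s : simplex X q.+1) :
  boundary (<< s >> : chain q.+1) =
  \sum_(j < q.+2) (-1) ^+ j *: << face j s >>.
Proof. exact: fglift1. Qed.

Lemma face0 x q (s : simplex X q) :
  face ord0 ([tuple of x :: s] : simplex X q.+1) = s.
Proof. by apply: eq_from_tnth => i; rewrite tnth_mktuple tnthS. Qed.

Lemma faceS x q j (s : simplex X q.+1) :
  face (fintype.lift ord0 j) ([tuple of x :: s] : simplex X q.+2) =
  [tuple of x :: face j s].
Proof.
apply: eq_from_tnth => i; rewrite tnth_mktuple.
case: (unliftP ord0 i) => [k|] ->; last first.
  have -> : fintype.lift (fintype.lift ord0 j) ord0 = ord0 by exact: val_inj.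
  by rewrite !tnth0.
rewrite tnthS tnth_mktuple -[RHS](tnthS x s).
by congr (tnth _ _); apply: val_inj; rewrite /= /bump !add1n ltnS addnS.
Qed.

Lemma face_map r q j (s : simplex X q.+1) :
  face j (map_tuple r s : simplex X q.+1) = map_tuple r (face j s).
Proof. by apply: eq_from_tnth => i; rewrite !(tnth_mktuple, tnth_map). Qed.

Lemma boundary_cone x q (c : chain q.+1) :
  boundary (cone x c) = c - cone x (boundary c).
Proof.
apply: (@freeg_linear_ext K _ _ (@boundary _ K _ \o @cone x _)
  (idfun \- (@cone x q \o @boundary _ K _))) => s /=.
rewrite cone1 !boundary1 big_ord_recl face0 expr0 scale1r; congr (_ + _).
rewrite linear_sum -sumrN; apply: eq_bigr => j _.
by rewrite faceS linearZ /= cone1 exprS mulN1r scaleNr.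
Qed.

Lemma boundary_push r q (c : chain q.+1) :
  boundary (push r c) = push r (boundary c).
Proof.
apply: (@freeg_linear_ext K _ _ (@boundary _ K _ \o @push r _)
  (@push r q \o @boundary _ K _)) => s /=.
rewrite push1 !boundary1 linear_sum; apply: eq_bigr => j _.
by rewrite face_map linearZ /= push1.
Qed.

Lemma push_cone r x q (c : chain q) :
  push r (cone x c) = cone (r x) (push r c).
Proof.
apply: (@freeg_linear_ext K _ _ (@push r _ \o @cone x _)
  (@cone (r x) q \o @push r _)) => s /=.
rewrite cone1 !push1 cone1; congr (<< _ >>); exact: val_inj.
Qed.

Lemma prism_cone r x q (c : chain q) :
  prism r (cone x c) = cone x (cone (r x) (push r c) - prism r c).
Proof.
rewrite -push_cone.
apply: (@freeg_linear_ext K _ _ (@prism r _ \o @cone x _)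
  (@cone x _ \o ((@push r _ \o @cone x q) \- @prism r _))) => s /=.
rewrite cone1 !prism1 push1 /= theadE; congr (cone x (_ - prism_simplex r _)).
exact: val_inj.
Qed.

(** The chain complex is not augmented, so the cone on a vertex does not obey
    [boundary_cone]. *)
Lemma boundary_edge x (s : simplex X 0) :
  boundary (cone x (<< s >> : chain 0)) =
  << s >> - << [tuple x] : simplex X 0 >>.
Proof.
rewrite cone1 boundary1 !big_ord_recl big_ord0 addr0 face0 expr0 scale1r.
rewrite expr1 scaleN1r; congr (_ - << _ >>); apply: eq_from_tnth => i.
by rewrite !ord1 tnth_mktuple !tnth0.
Qed.

(** The prism is a chain homotopy from the identity to [push r]. *)
Lemma boundary_prism r q (c : chain q.+1) :
  boundary (prism r c) = push r c - c - prism r (boundary c).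
Proof.
have swap n (A P S E : chain n) : A - P - (S - E) = A - S - (P - E).
  rewrite !opprB !addrA [LHS]addrAC [RHS]addrAC; congr (_ + _).
  exact: addrAC.
elim: q c => [|q IHq] c.
  apply: (@freeg_linear_ext K _ _ (@boundary _ K _ \o @prism r _)
    ((@push r _ \- idfun) \- (@prism r 0 \o @boundary _ K _))) => s /=.
  case/tupleP: s => x s; rewrite -cone1 prism_cone boundary_cone.
  rewrite [boundary (_ - _)]linearB /= push_cone push1.
  rewrite prism1 /= !boundary_edge [prism r (_ - _)]linearB /= !prism1 /= theadE.
  have -> : [tuple thead s] = s :> simplex X 0.
    by apply: eq_from_tnth => i; rewrite !ord1 tnth0.
  have -> : map_tuple r [tuple x] = [tuple r x] :> simplex X 0 by exact: val_inj.
  have -> (R Q S : chain 0) : R - Q - (R - S) = S - Q.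
    by rewrite opprB addrC addrA subrK.
  by rewrite [cone x (_ - _)]linearB; exact: swap.
apply: (@freeg_linear_ext K _ _ (@boundary _ K _ \o @prism r _)
  ((@push r _ \- idfun) \- (@prism r _ \o @boundary _ K _))) => s /=.
case/tupleP: s => x s; rewrite -cone1.
rewrite prism_cone boundary_cone linearB /= IHq boundary_cone push_cone.
rewrite boundary_cone [prism r (_ - _)]linearB /= prism_cone boundary_push.
have -> (R C S D : chain q.+1) : R - C - (R - S - D) = S - (C - D).
  rewrite -[R - S - D]addrA opprD addrACA subrr add0r opprD !opprK opprB.
  by rewrite addrCA (addrC D).
by rewrite [cone x (<< s >> - _)]linearB; exact: swap.
Qed.

Lemma boundary_prism0 r (c : chain 0) : boundary (prism r c) = push r c - c.
Proof.
apply: (@freeg_linear_ext K _ _ (@boundary _ K _ \o @prism r _)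
  (@push r _ \- idfun)) => s /=.
rewrite prism1 push1 boundary_edge; congr (_ - << _ >>).
by apply: eq_from_tnth => i; rewrite !ord1 tnth0.
Qed.
End Prism.

(** * Homology of a finite cover *)

Section Carrier.
Variables (K : fieldType) (S T : choiceType).

Definition carried (P : S -> Prop) (c : {freeg S / K}) :=
  forall s, s \in dom c -> P s.

Lemma carried0 P : carried P 0.
Proof. by move=> s; rewrite dom0. Qed.

Lemma carried_lin P a b c : carried P b -> carried P c -> carried P (a *: b + c).
Proof.
move=> Pb Pc s /domD_subset; rewrite mem_cat => /orP[/domZ_subset|].
  exact: Pb.
exact: Pc.
Qed.

Lemma carried1 (P : S -> Prop) s : P s -> carried P << s >>.
Proof. by move=> Ps t; rewrite domU1 inE => /eqP ->. Qed.

End Carrier.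

Lemma carried_fglift (K : fieldType) (S T : choiceType) (P : S -> Prop)
    (Q : T -> Prop) (f : S -> {freeg T / K}) (c : {freeg S / K}) :
  (forall s, P s -> carried Q (f s)) -> carried P c -> carried Q (fglift f c).
Proof.
move=> fPQ Pc; rewrite fgliftE big_seq.
elim/big_rec: _ => [|s d cs Qd]; first exact: carried0.
by apply: carried_lin Qd; apply: fPQ; exact: Pc.
Qed.

Section Retraction.
Variables (X : topologicalType) (K : fieldType) (U : open_cover X).
Variable r : X -> X.
Hypothesis rU : forall A x, cover_sets U A -> A x -> A (r x).
Local Notation chain := (chain X K).

(* Smallness itself is not inherited by cones; being contained in one fixed
   member of the cover is, provided that the apex lies in it. *)
Let all_in (A : set X) q (s : simplex X q) := forall i, A (tnth s i).

Let all_in_cons (A : set X) x q (s : simplex X q) :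
  A x -> all_in A s -> all_in A ([tuple of x :: s] : simplex X q.+1).
Proof.
move=> Ax As i; case: (unliftP ord0 i) => [j|] ->; first by rewrite tnthS.
by rewrite tnth0.
Qed.

Let all_in_map (A : set X) q (s : simplex X q) :
  cover_sets U A -> all_in A s -> all_in A (map_tuple r s : simplex X q).
Proof. by move=> UA As i; rewrite tnth_map; exact: rU. Qed.

Let carried_cone (A : set X) x q (c : chain q) :
  A x -> carried (@all_in A q) c -> carried (@all_in A q.+1) (cone x c).
Proof.
by move=> Ax; apply: carried_fglift => s As; apply: carried1; exact: all_in_cons.
Qed.

Let carried_prism_simplex (A : set X) q (s : simplex X q) :
  cover_sets U A -> all_in A s -> carried (@all_in A q.+1) (prism_simplex K r s).
Proof.
move=> UA; elim: q s => [|q IHq] s As /=.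
  by apply: carried_cone (As ord0) _; apply: carried1; exact: all_in_map.
apply: carried_cone (As ord0) _; rewrite addrC -scaleN1r.
apply: carried_lin; last by apply: carried1; exact: all_in_map.
apply: IHq => i; case/tupleP: s As => x s As.
have := As (fintype.lift ord0 i); rewrite tnthS.
by have -> : behead_tuple [tuple of x :: s] = s by exact: val_inj.
Qed.

Lemma small_chain_push q (c : chain q) :
  small_chain U c -> small_chain U (push r c).
Proof.
apply: carried_fglift => s [A UA As]; apply: carried1.
by exists A => //; exact: all_in_map.
Qed.

Lemma small_chain_prism q (c : chain q) :
  small_chain U c -> small_chain U (prism r c).
Proof.
apply: carried_fglift => s [A UA As] t /(carried_prism_simplex UA As) At.
by exists A.
Qed.

Lemma cycles_push q (c : chain q) : cycles K U q c -> cycles K U q (push r c).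
Proof.
move=> [Uc Zc]; split; first exact: small_chain_push.
by case: q c {Uc} Zc => //= q c Zc; rewrite boundary_push Zc linear0.
Qed.

Lemma push_homologous q (c : chain q) :
  cycles K U q c -> boundaries K U q (push r c - c).
Proof.
move=> [Uc Zc]; exists (prism r c); first exact: small_chain_prism.
case: q c {Uc} Zc => [|q] c /= Zc; first exact: boundary_prism0.
by rewrite boundary_prism Zc linear0 subr0.
Qed.

End Retraction.

Section FiniteFibres.
Variables (T : Type) (P : finType) (p : T -> P).

Lemma constant_on_fibres_range (S : eqType) (h : T -> S) :
  (forall t u, p t = p u -> h t = h u) -> exists l : seq S, forall t, h t \in l.
Proof.
move=> hp; pose sec a := if pselect (exists t, p t = a) is left ex
  then Some (h (sval (cid ex))) else None.
exists (pmap sec (enum P)) => t; rewrite mem_pmap; apply/mapP.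
exists (p t); first by rewrite mem_enum.
rewrite /sec; case: pselect => [ex|[]]; last by exists t.
by congr Some; apply: hp; case: cid.
Qed.

Lemma fibre_representatives :
  exists r : T -> T, (forall t, p (r t) = p t) /\
    forall t u, p t = p u -> r t = r u.
Proof.
pose sec a (ex : exists t, p t = a) := sval (cid ex).
have secP a ex : p (@sec a ex) = a by rewrite /sec; case: cid.
exists (fun t => sec _ (ex_intro (fun u => p u = p t) t erefl)).
split=> [t|t u]; first exact: secP.
move: (ex_intro _ t _) (ex_intro _ u _) => /= ext exu ptu.
by case: _ / ptu exu => exu; congr sec; exact: Prop_irrelevance.
Qed.

End FiniteFibres.

(** The pattern of [x] records which members of the finite cover contain [x]; a
    map [r] that sends [x] to a chosen point with the same pattern preserves
    smallness and has finite range. So each cycle is homologous to its image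
    under [push r], which lies in the space [G] of cycles carried by the finite
    list [l], and coefficients on [l] are finitely many functionals that separate
    the elements of [G]. *)
Lemma homology_spanned (X : topologicalType) (K : fieldType) (U : open_cover X)
    (q : nat) : finite_set (cover_sets U) ->
  exists n (b : 'I_n -> chain X K q), (forall i, cycles K U q (b i)) /\
    forall c, cycles K U q c ->
      exists k : 'I_n -> K, boundaries K U q (\sum_i k i *: b i - c).
Proof.
move=> /finite_fsetP[D UD].
pose pat x := [ffun A : D => `[< val A x >]].
have [r [pat_r r_pat]] := fibre_representatives pat.
have rU A x : cover_sets U A -> A x -> A (r x).
  rewrite UD /= => DA Ax.
  have /ffunP/(_ [` DA]%fset) := pat_r x; rewrite !ffunE /= => rxA.
  by apply/asboolP; rewrite rxA; exact/asboolP.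
have [l lP] : exists l : seq (simplex X q), forall s, map_tuple r s \in l.
  apply: (@constant_on_fibres_range _ _
    (fun s : simplex X q => [ffun i => pat (tnth s i)])).
  move=> s t /ffunP st; apply: eq_from_tnth => i; rewrite !tnth_map.
  by apply: r_pat; have := st i; rewrite !ffunE.
pose in_l (s : simplex X q) : Prop := s \in l.
have G_lin a (b c : chain X K q) :
    cycles K U q b /\ carried in_l b -> cycles K U q c /\ carried in_l c ->
    cycles K U q (a *: b + c) /\ carried in_l (a *: b + c).
  by move=> [Zb lb] [Zc lc]; split; [exact: subspace_lin|exact: carried_lin].
pose G := Defs.Subspace
  (conj (subspace0 (cycles K U q)) (@carried0 K _ in_l)) G_lin.
pose f (i : 'I_(size l)) : {linear chain X K q -> K^o} :=
  fglift (fun s => (s == tnth (in_tuple l) i)%:R : K^o).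
have [c [lc Zc]|b [Gb b_span]] := @spanned_of_joint_kernel _ _ _ f G.
  move=> fc; apply/eqP; rewrite -dom_eq0; case E : (dom c) => [//|s d].
  have sc : s \in dom c by rewrite E mem_head.
  have /seq_tnthP[i si] : s \in l := Zc s sc.
  by move: sc; rewrite mem_dom si /coeff [fglift _ _]fc eqxx.
exists (size l), b; split=> [i|c Zc]; first exact: (Gb i).1.
have [|k Ek] := b_span (push r c); last first.
  by exists k; rewrite -Ek; exact: push_homologous.
split; first exact: cycles_push.
case: Zc => + _; apply: carried_fglift => s _; apply: carried1; exact: lP.
Qed.

(** * Cochains as functionals on chains *)

Section CochainsAsFunctionals.
Variables (X : topologicalType) (K : fieldType) (q : nat).
Implicit Types (U V : open_cover X) (c : chain X K q) (xi : cochain X K q).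
Implicit Types (z : cech_cohomology X K q) (gamma : cech_homology X K q).

Definition eval_at c : cochain X K q -> K^o := fun xi => Defs.eval xi c.
Fact eval_at_is_linear c : linear (eval_at c).
Proof. by move=> a xi eta; exact: eval_linl. Qed.
HB.instance Definition _ c :=
  GRing.isLinear.Build K (cochain X K q) K^o *:%R (eval_at c)
    (eval_at_is_linear c).

Lemma eval1 n (eta : cochain X K n) s : Defs.eval eta << s >> = eta s.
Proof. exact: fglift1. Qed.

Lemma eval_of_functional n (g : {linear chain X K n -> K^o}) (c : chain X K n) :
  Defs.eval (fun s => g << s >>) c = g c.
Proof.
apply: (@freeg_linear_ext K _ _ (Defs.eval (fun s => g << s >>)) g) => s.
exact: eval1.
Qed.

Lemma coboundary_eval n (eta : cochain X K n) s :
  coboundary eta s = Defs.eval eta (boundary << s >>).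
Proof. by rewrite eval_boundary eval1. Qed.

Lemma small_chain1 U n (s : simplex X n) :
  small U s -> small_chain U (<< s >> : chain X K n).
Proof. exact: carried1. Qed.

Lemma cohomology_class U xi :
  zero_on U (coboundary xi) -> exists z, cochain_represents xi z.
Proof.
move=> Uxi.
suff Zxi : ker (@as_coboundary X K q) (quotmod_pi _ xi).
  by exists (subquot_class _ Zxi), Zxi.
by rewrite /= as_coboundaryE; apply/quotmod_pi_eq0; exists U.
Qed.

(** A functional on chains that vanishes on the boundaries of U-small chains is
    a cochain of the kind tested here. *)
Lemma boundaries_detect U c :
  (forall xi, zero_on U (coboundary xi) -> Defs.eval xi c = 0) ->
  boundaries K U q c.
Proof.
move=> xic; apply: contrapT => /separation[g [gB gc]].
suff /xic /eqP : zero_on U (coboundary (fun s => g << s >>)).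
  by rewrite eval_of_functional gc oner_eq0.
move=> s Us; rewrite coboundary_eval eval_of_functional; apply: gB.
by exists << s >> => //; exact: small_chain1.
Qed.

End CochainsAsFunctionals.

(** In positive degree, the value of [xi] on a U-small chain [b] depends only
    on the boundary of [b], so that [xi] factors through the boundary on
    U-small chains; an extension of the factor to all chains is a cochain whose
    coboundary agrees with [xi] on U-small simplices. *)
Lemma cocycle_vanishing_on_cycles (X : topologicalType) (K : fieldType) q U
    (xi : cochain X K q) :
  (forall c, cycles K U q c -> Defs.eval xi c = 0) ->
  as_coboundaries X K q (quotmod_pi _ xi).
Proof.
case: q xi => [|q] xi xiZ.
  apply/quotmod_pi_eq0; exists U => s Us; rewrite -eval1; apply: xiZ.
  by split=> //; exact: small_chain1.
pose small_chains := Defs.Subspace (@small_chain0 X K U q.+1)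
  (@small_chain_lin X K U q.+1).
have [c Uc Zc|g gP] := extension_along (D := @boundary X K q) (f := Defs.eval xi)
  (S := small_chains); first by apply: xiZ; split.
pose eta : cochain X K q := fun s => g << s >>.
exists (quotmod_pi (locally_zero X K q) eta); rewrite [LHS]as_coboundaryE.
apply/quotmod_piP; exists U => s Us.
have -> : (coboundary eta - xi) s = coboundary eta s - xi s by [].
rewrite coboundary_eval eval_of_functional gP; first by rewrite /= eval1 subrr.
exact: small_chain1.
Qed.

(** * The duality *)

Section Realization.
Variables (X : topologicalType) (K : fieldType) (q : nat).
Implicit Types (U V : open_cover X) (c : chain X K q) (xi : cochain X K q).
Implicit Types (z : cech_cohomology X K q) (gamma : cech_homology X K q).

Lemma cohomology_class_eq0 U xi z :
  cochain_represents xi z ->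
  (forall c, cycles K U q c -> Defs.eval xi c = 0) -> z = 0.
Proof.
move=> [Zxi <-] /cocycle_vanishing_on_cycles Bxi.
exact/quotmod_pi_eq0.
Qed.

Lemma homology_to_dual_injective : injective (@homology_to_dual X K q).
Proof.
suff ker0 gamma : homology_to_dual gamma = 0 -> gamma = 0.
  move=> beta gamma bg; apply/eqP; rewrite -subr_eq0; apply/eqP/ker0.
  by rewrite linearB /= bg subrr.
move=> Lgamma; apply: val_inj; apply: functional_extensionality_dep => U.
have [c Uc] := representative_exists gamma U.
suff Bc : boundaries K U q c.
  rewrite linear0; change (component gamma U = 0).
  by case: Uc => Zc <-; exact/quotmod_pi_eq0.
apply: boundaries_detect => xi Uxi.
have [z xiz] := cohomology_class Uxi.
by rewrite -(integralE xiz Uxi Uc) -[LHS]/(homology_to_dual gamma z) Lgamma.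
Qed.

Variable phi : {linear cech_cohomology X K q -> K^o}.

(** The cycle [c] represents over [U] the element of Cech homology that
    corresponds to [phi]. *)
Definition realizes U c := cycles K U q c /\ forall xi z,
  zero_on U (coboundary xi) -> cochain_represents xi z -> Defs.eval xi c = phi z.

Lemma realizes_unique U b c :
  realizes U b -> realizes U c -> boundaries K U q (b - c).
Proof.
move=> [_ bP] [_ cP]; apply: boundaries_detect => xi Uxi.
have [z xiz] := cohomology_class Uxi.
by rewrite linearB /= (bP _ _ Uxi xiz) (cP _ _ Uxi xiz) subrr.
Qed.

Lemma realizes_refines V U c : refines V U -> realizes V c -> realizes U c.
Proof.
move=> VU [Zc cP]; split; first exact: cycles_refines Zc.
by move=> xi z Uxi; apply: cP; exact: zero_on_refines Uxi.
Qed.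

(** The pairs [(xi, z)] of a cocycle over [U] and its class form a vector space,
    on which [phi z] and the values of [xi] at the spanning cycles [b i] are
    functionals. If the latter vanish, so does [xi] on all U-small cycles, hence
    [z = 0] and [phi z = 0]. So the former is a combination of the latter. *)
Lemma realizes_finite U : finite_set (cover_sets U) -> exists c, realizes U c.
Proof.
move=> finU; have [n [b [Zb b_span]]] := @homology_spanned X K U q finU.
pose W : lmodType K := (cochain X K q * cech_cohomology X K q)%type.
have G_lin a (v w : W) :
    zero_on U (coboundary v.1) /\ cochain_represents v.1 v.2 ->
    zero_on U (coboundary w.1) /\ cochain_represents w.1 w.2 ->
    zero_on U (coboundary (a *: v + w).1) /\
    cochain_represents (a *: v + w).1 (a *: v + w).2.
  move=> [Uv rv] [Uw rw]; split; last exact: cochain_represents_linear.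
  by rewrite linearP; exact: zero_on_lin.
have G0 :
    zero_on U (coboundary (0 : W).1) /\ cochain_represents (0 : W).1 (0 : W).2.
  split; first by move=> s _; rewrite linear0.
  have [xi [V [xi0 _]]] := @cochain_exists X K q 0.
  by have := cochain_represents_linear (-1) xi0 xi0; rewrite !scaleN1r !addNr.
pose G := @Defs.Subspace K W (fun v => zero_on U (coboundary v.1) /\
  cochain_represents v.1 v.2) G0 G_lin.
pose f i : {linear W -> K^o} := eval_at (b i) \o fst.
pose g : {linear W -> K^o} := phi \o snd.
have [[xi z] [/= Uxi xiz] fxi|k kP] :=
    combination_of_joint_kernel (f := f) (g := g) (G := G).
  rewrite /g /= (cohomology_class_eq0 (U := U) xiz) ?linear0 // => c Zc.
  have [k [d Ud db]] := b_span c Zc.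
  have /eqP : Defs.eval xi (boundary d) = 0.
    by rewrite eval_boundary; exact: eval_zero_on Ud.
  rewrite db linearB subr_eq0 => /eqP <-; rewrite linear_sum big1 // => i _.
  rewrite linearZ /= -[Defs.eval xi (b i)]/(eval_at (b i) xi) fxi.
  exact: mulr0.
exists (\sum_i k i *: b i); split=> [|xi z Uxi xiz].
  elim/big_rec: _ => [|i x _ Zx]; first exact: subspace0.
  exact: subspace_lin.
rewrite linear_sum -[phi z]/(g (xi, z)) kP //.
by apply: eq_bigr => i _; rewrite linearZ.
Qed.

End Realization.

Lemma finite_refinement (X : topologicalType) (U : open_cover X) :
  compact [set: X] ->
  exists2 V : open_cover X, finite_set (cover_sets V) & refines V U.
Proof.
move=> cptX.
have [D DU XD] : exists2 D : {fset (set X)},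
    {subset D <= cover_sets U} & forall x, cover [set` D] id x.
  have [[x0 _]|X0] := pselect (exists x : X, True); last first.
    by exists fset0 => // x; case: X0; exists x.
  (* A nonempty space is viewed as a pointed one: [compact_cover] is about
     pointed spaces. *)
  pose Xp : ptopologicalType :=
    HB.pack (X : Type) (Topological.on X) (isPointed.Build X x0).
  have : @compact Xp [set: X] := cptX.
  rewrite compact_cover => /(_ _ (cover_sets U) id)[A|x _|D DU XD].
  - exact: cover_open.
  - have [A UA Ax] : (\bigcup_(A in cover_sets U) A) x by rewrite cover_setT.
    by exists A.
  - by exists D => // x; exact: XD.
have VU A : [set` D] A -> cover_sets U A by move=> /DU; rewrite inE.
have V_open A : [set` D] A -> open A by move=> /VU; exact: cover_open.
have V_setT : \bigcup_(A in [set` D]) A = [set: X].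
  by apply/seteqP; split=> // x _; exact: XD.
exists (OpenCover V_open V_setT); first exact: finite_fset.
by move=> A /VU UA; exists A.
Qed.

(** Coherence holds for any choice of realizing cycles, by uniqueness. *)
Lemma homology_to_dual_surjective (X : topologicalType) (K : fieldType) q
    (phi : {linear cech_cohomology X K q -> K^o}) :
  compact [set: X] -> exists gamma, homology_to_dual gamma = phi.
Proof.
move=> cptX.
have /choice[c cP] U : exists c, realizes phi U c.
  have [V finV VU] := finite_refinement U cptX.
  have [c Vc] := realizes_finite phi finV.
  by exists c; exact: realizes_refines Vc.
pose f : prodmod (fun U : open_cover X => homology K U q) :=
  fun U => subquot_class _ (cP U).1.
have f_coherent : coherent X K q f.
  move=> V U VU.
  have fV : represents (c V) (f V) by exists (cP V).1.
  have [Zc Ec] := represents_incl (cycles_refines VU (q := q))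
    (boundaries_refines VU (q := q)) fV.
  apply: etrans (esym Ec) _; apply/subquot_classP.
  apply: realizes_unique (cP U).
  exact: realizes_refines (cP V).
exists (in_submod f_coherent); apply: linear_ext => z.
have [xi [U [xiz Uxi]]] := cochain_exists z.
have Uc : representative U (c U) (in_submod f_coherent) by exists (cP U).1.
rewrite -[LHS]/(integral _ z) (integralE xiz Uxi Uc).
exact: (cP U).2.
Qed.

Theorem theorem22 (X : topologicalType) (K : fieldType) (q : nat)
    (cptX : compact [set: X]) :
  let toHomCohomology : {linear cech_homology X K q ->
        {linear cech_cohomology X K q -> K^o}} :=
    @homology_to_dual X K q in
  let toHomHomology : {linear cech_cohomology X K q ->
        {linear cech_homology X K q -> K^o}} :=
    @cohomology_to_dual X K q in
  bijective toHomCohomology /\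
  injective toHomHomology /\
  (finite_dimensional (cech_homology X K q) \/
     finite_dimensional (cech_cohomology X K q) ->
   [/\ bijective toHomHomology,
       finite_dimensional (cech_homology X K q) &
       finite_dimensional (cech_cohomology X K q)]).
Proof.
move=> L R.
have bij (S T : lmodType K) (f : S -> T) :
    injective f -> (forall y, exists x, f x = y) -> bijective f.
  move=> f_inj /choice[g fg]; exists g => // x.
  by apply: f_inj; rewrite fg.
have LR gamma z : R z gamma = L gamma z by [].
have L_inj : injective L := @homology_to_dual_injective X K q.
have L_surj phi : exists gamma, L gamma = phi.
  exact: homology_to_dual_surjective.
have R_inj := pairing_injective LR L_surj.
split; first exact: bij.
split=> // fin.
have finC : finite_dimensional (cech_cohomology X K q).
  by case: fin => //; exact: finite_dimensional_right LR L_surj.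
split=> //; last exact: finite_dimensional_left LR L_inj finC.
by apply: bij => //; exact: pairing_surjective LR L_inj finC.
Qed.
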